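(* Let $\mathcal{D}^{\beta}$ be a dyadic grid in $\mathbb{R}^d$, let $\{\lambda_{Q}\}_{Q \in \mathcal{D}^{\beta}}$ be a sequence of positive numbers, and let $\sigma_{1},\dots,\sigma_{n}$ be weights on $\mathbb{R}^{d}$. Assume that $\Phi_{1},\dots,\Phi_{n},\Psi\in \mathcal{U}$ and that $\Phi$ is a bijection from $\mathbb{R}_{+}$ to $\mathbb{R}_{+}$ such that $\Phi^{-1}=\Phi_{1}^{-1}\times\cdots\times \Phi_{n}^{-1}$ (pointwise product) and $t\mapsto \frac{\Psi(t)}{\Phi(t)}$ is increasing on $\mathbb{R}_{+}^{*}$. Define $$\nu_{\vec{\sigma}}:=\frac{1}{\Phi\left(\prod_{i=1}^{n}\Phi_{i}^{-1}\left(\frac{1}{\sigma_{i}}\right)\right)}.$$ If there exist constants $C_{1},C_{2}>0$ such that $$\frac{1}{\nu_{\vec{\sigma}}(Q)} \leq C_{1}\Phi\left(\prod_{i=1}^{n}\Phi_{i}^{-1}\left(\frac{1}{\sigma_{i}(Q)}\right)\right)\qquad\text{for all } Q \in \mathcal{D}^{\beta},$$ and $$\sum_{Q\in \mathcal{D}^{\beta}}\lambda_{Q}\Psi\left(\prod_{i=1}^{n}m_{\sigma_{i}}\left(\frac{f_{i}}{\|f_{i}\|_{L_{\sigma_{i}}^{\Phi_{i}}}^{lux}},Q\right)\right) \leq C_{2}\qquad\text{for all } 0\not\equiv f_{i}\in L^{\Phi_{i}}(\sigma_{i}),\ i=1,\dots,n,$$ then $\{\lambda_{Q}\}_{Q \in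 \mathcal{D}^{\beta}}$ is a $(\nu_{\vec{\sigma}}, \Psi \circ \Phi^{-1})$-Carleson sequence.
   Context: $\mathbb{R}_+=[0,\infty)$ and $\mathbb{R}_+^*=(0,\infty)$. A weight is a locally integrable, almost everywhere positive function $\sigma$ on $\mathbb{R}^d$; $\sigma(E)=\int_E\sigma(x)\,dx$ (the same notation is used for $\nu_{\vec\sigma}$). For a cube $Q$, $m_\sigma(f,Q):=\frac{1}{\sigma(Q)}\int_Q|f(x)|\sigma(x)\,dx$. A growth function is a function $\Phi:\mathbb{R}_+\to\mathbb{R}_+$, not identically zero, continuous, nondecreasing and onto. It is of upper-type $q>0$ if there is $C_q>0$ with $\Phi(st)\le C_q t^q\Phi(s)$ for all $s>0$, $t\ge 1$. For $q\ge1$, $\mathcal{U}^q$ is the set of growth functions of upper-type $q$ such that $t\mapsto\Phi(t)/t$ is nondecreasing on $\mathbb{R}_+^*$; $\mathcal{U}=\bigcup_{q\ge1}\mathcal{U}^q$. Standing convention: (up to replacing it by an equivalent function) every $\Phi\in\mathcal{U}$ is assumed convex, of class $C^1$, with $\Phi'(t)\approx\Phi(t)/t$ for $t>0$. For $\Phi\in\mathcal{U}$ and a weight $\sigma$, $L^\Phi(\sigma)$ is the set of (classes of) measurable $f:\mathbb{R}^d\to\mathbb{C}$ with $\|f\|_{L^\Phi_\sigma}^{lux}:=\inf\{\lambda>0:\int_{\mathbb{R}^d}\Phi(|f(x)|/\lambda)\sigma(x)dx\le1\}<\infty$. A dyadic grid $\mathcal{D}^\beta$ in $\mathbb{R}^d$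 is a collection of cubes such that: each has sidelength $2^k$ for some $k\in\mathbb{Z}$; for $Q,Q'\in\mathcal{D}^\beta$, $Q\cap Q'\in\{Q,Q',\emptyset\}$; for each $k\in\mathbb{Z}$ the cubes of sidelength $2^k$ in $\mathcal{D}^\beta$ form a partition of $\mathbb{R}^d$. For an increasing function $\Theta$ and a weight $\sigma$, a sequence $\{\lambda_Q\}_{Q\in\mathcal{D}^\beta}$ is $(\sigma,\Theta)$-Carleson if there is $\Lambda>0$ such that $\sum_{Q\subset R,\,Q\in\mathcal{D}^\beta}\lambda_Q\le\Lambda/\Theta\left(\frac{1}{\sigma(R)}\right)$ for all $R\in\mathcal{D}^\beta$. *)

(* Defs.v *)
From HB Require Import structures.
From mathcomp Require Import all_boot all_order all_algebra.
From mathcomp Require Import all_classical all_reals all_analysis.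
From mathcomp Require Import complex.

Set Implicit Arguments.
Unset Strict Implicit.
Unset Printing Implicit Defensive.

Import Order.TTheory GRing.Theory Num.Theory.
Import numFieldNormedType.Exports.

Local Open Scope classical_set_scope.
Local Open Scope ring_scope.

(* R^n carries the sigma-algebra generated by the coordinates, i.e. the Borel
   sets, so that Lebesgue measure can be built as an iterated product. *)
Definition rV_display (R : realType) (n : nat) : measure_display.
Proof. by constructor. Qed.

Section rV_measurable.
Context {R : realType} {n : nat}.

Let coord (i : 'I_n) (x : 'rV[R]_n) : R := x ord0 i.

Let rV_set0 : g_sigma_preimage coord set0.
Proof. exact: sigma_algebra0. Qed.

Let rV_setC A : g_sigma_preimage coord A -> g_sigma_preimage coord (~` A).
Proof. exact: sigma_algebraC. Qed.

Let rV_bigcup (F : (set 'rV[R]_n)^nat) : (forall i, g_sigma_preimage coord (F i)) ->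
  g_sigma_preimage coord (\bigcup_i (F i)).
Proof. exact: sigma_algebra_bigcup. Qed.

HB.instance Definition _ := @isMeasurable.Build (rV_display R n)
  'rV[R]_n (g_sigma_preimage coord) rV_set0 rV_setC rV_bigcup.

End rV_measurable.

Lemma measurable_coord_rV (R : realType) n (i : 'I_n) :
  measurable_fun [set: 'rV[R]_n] (fun x : 'rV[R]_n => x ord0 i).
Proof.
move=> _ Y mY; rewrite setTI; apply: sub_sigma_algebra => /=.
rewrite -bigcup_seq/=; exists i => /=; first by rewrite mem_index_enum.
by exists Y => //; rewrite setTI.
Qed.

Lemma measurable_fun_rV d (T : measurableType d) (R : realType) n
    (f : T -> 'rV[R]_n) :
  (forall i, measurable_fun [set: T] (fun x => f x ord0 i)) ->
  measurable_fun [set: T] f.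
Proof.
move=> mf.
suff prefS : g_sigma_preimage (fun i => (fun v : 'rV[R]_n => v ord0 i) \o f)
    `<=` measurable.
  move=> _ A mA; apply: prefS; rewrite g_sigma_preimage_comp.
  by exists A.
apply: smallest_sub; first exact: sigma_algebra_measurable.
rewrite -bigcup_seq; apply: bigcup_sub => i _.
by move=> A [B mB <-]; exact: mf.
Qed.

Section cons_rV.
Context {R : realType} {n : nat}.

Definition cons_rV (p : measurableTypeR R * 'rV[R]_n) : 'rV[R]_n.+1 :=
  \row_i (if unlift ord0 i is Some j then p.2 ord0 j else p.1).

Definition uncons_rV (v : 'rV[R]_n.+1) : measurableTypeR R * 'rV[R]_n :=
  (v ord0 ord0, \row_j v ord0 (lift ord0 j)).

Lemma cons_rVK : cancel cons_rV uncons_rV.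
Proof.
move=> [x v]; rewrite /uncons_rV mxE unlift_none; congr pair.
by apply/rowP => j; rewrite !mxE liftK.
Qed.

Lemma measurable_cons_rV : measurable_fun [set: measurableTypeR R * 'rV[R]_n] cons_rV.
Proof.
apply: measurable_fun_rV => i; under eq_fun do rewrite mxE.
case: unliftP => [j _|_]; last exact: measurable_fst.
exact: measurableT_comp (measurable_coord_rV j) measurable_snd.
Qed.

Lemma measurable_uncons_rV : measurable_fun [set: 'rV[R]_n.+1] uncons_rV.
Proof.
apply: measurable_fun_pair; first exact: measurable_coord_rV.
apply: measurable_fun_rV => j; under eq_fun do rewrite mxE.
exact: measurable_coord_rV.
Qed.

End cons_rV.

(* Transport of the product of lebesgue_measure and mu along
   R * R^n ~ R^(n+1). *)
Section lebesgue_rVS.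
Context {R : realType} {n : nat}.
Variable mu : {sigma_finite_measure set 'rV[R]_n -> \bar R}.

Definition lebesgue_rVS : set 'rV[R]_n.+1 -> \bar R :=
  pushforward (@lebesgue_measure R \x mu)%E cons_rV.

Let prodm : {measure set (measurableTypeR R * 'rV[R]_n)%type -> \bar R} :=
  (@lebesgue_measure R \x mu)%E.

Let pm : {measure set 'rV[R]_n.+1 -> \bar R} :=
  measure_function_pushforward__canonical__measure_function_Measure
    prodm measurable_cons_rV.

HB.instance Definition _ := isMeasure.Build _ _ _ lebesgue_rVS
  (measure0 pm) (measure_ge0 pm) (@measure_semi_sigma_additive _ _ _ pm).

Lemma lebesgue_rVSE (A : set R) (B : set 'rV[R]_n) :
  measurable A -> measurable B ->
  lebesgue_rVS (uncons_rV @^-1` (A `*` B)) = (lebesgue_measure A * mu B)%E.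
Proof.
move=> mA mB; rewrite /lebesgue_rVS /pushforward -comp_preimage.
rewrite (_ : uncons_rV \o cons_rV = id); last exact/funext/cons_rVK.
exact: product_measure1E.
Qed.

Let lebesgue_rVS_sigma_finite : sigma_finite setT lebesgue_rVS.
Proof.
have sfl : sigma_finite [set: measurableTypeR R] (@lebesgue_measure R).
  exact: sigma_finiteT.
have /sigma_finiteP[F [TF ndF Foo]] := sfl.
have /sigma_finiteP[G [TG ndG Goo]] := sigma_finiteT mu.
exists (fun k => uncons_rV @^-1` (F k `*` G k)).
  rewrite -preimage_bigcup; apply/esym/seteqP; split => // v _.
  have [i _ Fi] : (\bigcup_i F i) (uncons_rV v).1 by rewrite -TF.
  have [j _ Gj] : (\bigcup_i G i) (uncons_rV v).2 by rewrite -TG.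
  exists (maxn i j) => //; split.
    by move: Fi; exact/subsetPset/ndF/leq_maxl.
  by move: Gj; exact/subsetPset/ndG/leq_maxr.
move=> k; have [mF Fk] := Foo k; have [mG Gk] := Goo k; split.
  rewrite -[X in measurable X]setTI; apply: measurable_uncons_rV => //.
  exact: measurableX.
by rewrite lebesgue_rVSE// lte_mul_pinfty// ge0_fin_numE.
Qed.

HB.instance Definition _ := Measure_isSigmaFinite.Build _ _ _ lebesgue_rVS
  lebesgue_rVS_sigma_finite.

End lebesgue_rVS.

Section lebesgue_rV0.
Context {R : realType}.

Definition lebesgue_rV0 : set 'rV[R]_0 -> \bar R := \d_(0 : 'rV[R]_0).

HB.instance Definition _ := Measure.on lebesgue_rV0.
HB.instance Definition _ := SigmaFiniteMeasure.on lebesgue_rV0.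

End lebesgue_rV0.

Fixpoint lebesgue_rV (R : realType) (n : nat) :
    {sigma_finite_measure set 'rV[R]_n -> \bar R} :=
  if n is m.+1 then lebesgue_rVS (lebesgue_rV R m) else lebesgue_rV0.

(* The carrier of euclid R d is 'rV[R]_d. Completing the Borel measure makes the measurable sets and functions on R^d
   the Lebesgue measurable ones. *)
Definition euclid (R : realType) (d : nat) : measurableType _ :=
  caratheodory_type (lebesgue_rV R d)^*%mu.

Definition lebesgue_euclid (R : realType) (d : nat) : set (euclid R d) -> \bar R :=
  @completed_measure_extension _ _ _ (lebesgue_rV R d).

HB.instance Definition _ R d := Measure.on (@lebesgue_euclid R d).
HB.instance Definition _ R d :=
  @Measure_isSigmaFinite.Build _ _ _ (@lebesgue_euclid R d)
  (completed_measure_extension_sigma_finite (sigma_finiteT (lebesgue_rV R d))).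

(* A growth function is a function R -> R of which only the restriction to
   [0, +oo[ is constrained or used. *)
Section growth_functions.
Context {R : realType}.
Implicit Types (Phi : R -> R) (q : R).

Definition growth_function Phi : Prop :=
  [/\ set_fun `[0, +oo[ `[0, +oo[ Phi,
      exists2 t, 0 <= t & Phi t != 0,
      {within `[0, +oo[, continuous Phi},
      {in `[0, +oo[ &, {homo Phi : s t / s <= t}} &
      set_surj `[0, +oo[ `[0, +oo[ Phi].

Definition upper_type q Phi : Prop :=
  0 < q /\ exists2 C, 0 < C &
    forall s t, 0 < s -> 1 <= t -> Phi (s * t) <= C * t `^ q * Phi s.

Definition class_Uq q Phi : Prop :=
  [/\ growth_function Phi, upper_type q Phi &
      {in `]0, +oo[ &, {homo (fun t => Phi t / t) : s t / s <= t}}].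

Definition class_U Phi : Prop := exists2 q, 1 <= q & class_Uq q Phi.

(* Standing normalization of the functions of class_U.
   For a convex function, being C^1 on ]0, +oo[ is the same as being C^1 on
   [0, +oo[ with a one-sided derivative at 0. *)
Definition regular_growth Phi : Prop :=
  [/\ convex_function (`[0, +oo[ : set R^o) Phi,
      {in `]0, +oo[, forall t, derivable Phi t 1},
      {in `]0, +oo[, continuous Phi^`()%classic} &
      exists c C : R, [/\ 0 < c, 0 < C &
        forall t, 0 < t -> c * (Phi t / t) <= Phi^`()%classic t <= C * (Phi t / t)]].

(* Inverse of a bijection of [0, +oo[, extended by 0 to the negative reals. *)
Definition inv_plus Phi : R -> R := 'pinv_(fun=> 0) `[0, +oo[ Phi.

End growth_functions.

Section weights.
Context {R : realType} {d : nat}.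
Implicit Types (sigma : euclid R d -> R) (f : euclid R d -> R[i]).
Implicit Types (Q E : set (euclid R d)).

Local Notation mu := (@lebesgue_euclid R d).

Definition weight sigma : Prop :=
  [/\ measurable_fun setT sigma,
      forall K : set 'rV[R]_d, compact K ->
        (\int[mu]_(x in K) `|sigma x|%:E < +oo)%E &
      {ae mu, forall x, 0 < sigma x}].

(* This and weighted_mean below are real-valued, with value 0 when the integral
   is infinite; for weights and cubes the integral is finite. *)
Definition weighted_measure sigma E : R := \int[mu]_(x in E) sigma x.

Definition weighted_mean sigma f Q : R :=
  (weighted_measure sigma Q)^-1 *
  \int[mu]_(x in Q) (ComplexField.Normc.normc (f x) * sigma x).

Definition luxemburg_norm (Phi : R -> R) sigma f : \bar R :=
  ereal_inf [set l%:E | l in [set l : R | 0 < l /\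
    (\int[mu]_x (Phi (ComplexField.Normc.normc (f x) / l) * sigma x)%:E <= 1)%E]].

(* Functions are not quotiented by equality almost everywhere. *)
Definition orlicz (Phi : R -> R) sigma : set (euclid R d -> R[i]) :=
  [set f | [/\ measurable_fun setT (fun x => complex.Re (f x)),
               measurable_fun setT (fun x => complex.Im (f x)) &
               (luxemburg_norm Phi sigma f < +oo)%E]].

Definition ae_zero f : Prop := {ae mu, forall x, f x = 0}.

Definition nu_sigma (n : nat) (Phi : R -> R) (Phis : 'I_n -> R -> R)
    (sigmas : 'I_n -> euclid R d -> R) : euclid R d -> R :=
  fun x => (Phi (\prod_(i < n) inv_plus (Phis i) (sigmas i x)^-1))^-1.

(* Each of the faces of a cube may or may not belong to it. *)
Definition cube (l : R) Q : Prop :=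
  exists (a : 'I_d -> R) (b c : 'I_d -> bool),
    Q = [set x : 'rV[R]_d | forall i,
          x ord0 i \in Interval (BSide (b i) (a i)) (BSide (c i) (a i + l))].

Definition dyadic_grid (D : set (set (euclid R d))) : Prop :=
  [/\ forall Q, D Q -> exists k : int, cube (2 ^ k) Q,
      forall Q Q', D Q -> D Q' ->
        [\/ Q `&` Q' = Q, Q `&` Q' = Q' | Q `&` Q' = set0] &
      forall k : int, partition [set Q | D Q /\ cube (2 ^ k) Q] id setT].

Definition carleson (D : set (set (euclid R d))) sigma (Theta : R -> R)
    (lambda : set (euclid R d) -> R) : Prop :=
  exists2 L : R, 0 < L & forall S, D S ->
    (\esum_(Q in [set Q | D Q /\ Q `<=` S]) (lambda Q)%:E
       <= (L / Theta (weighted_measure sigma S)^-1)%:E)%E.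

End weights.

(* Main.v *)
Require Import Defs.
From mathcomp Require Import all_boot all_order all_algebra.
From mathcomp Require Import all_classical all_reals all_analysis.
From mathcomp Require Import measurable_realfun complex.

(** The Carleson condition on a cube [S] is the testing condition applied to
    the indicator of [S] in all [n] slots.  Write [w i] for the
    [sigma i]-measure of [S] and [P] for the product of the numbers
    [inv_plus (Phis i) (w i)^-1].

    The Luxemburg norm of the indicator of [S] is
    [(inv_plus (Phis i) (w i)^-1)^-1], and the mean over any cube [Q] inside
    [S] of the indicator of [S] is 1.  Hence for every such [Q] the argument of
    [Psi] in the testing sum is exactly [P], and that sum bounds the sum of
    [lambda Q] over the cubes [Q] of the grid inside [S] by [C2 / Psi P].

    It remains to compare [Psi P] with [Psi (inv_plus Phi w)], where [w] is the
    inverse of the [nu]-measure of [S].  Put [c := max 1 C1].  The hypothesis on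
    [nu] gives [w <= c * Phi P].  Since [Phis i t / t] is nondecreasing, each
    inverse satisfies [inv (c * y) <= c * inv y], so the product [inv_plus Phi]
    loses at most the factor [c ^+ n], and [inv_plus Phi w <= c ^+ n * P].  The
    upper type [q] of [Psi] then gives
    [Psi (inv_plus Phi w) <= Cq * (c ^+ n) `^ q * Psi P].

    For the quotients to mean what they should, the [sigma i]- and
    [nu]-measures of a cube have to be positive and finite.  Positivity holds
    because the densities are positive almost everywhere and a cube has
    positive Lebesgue measure.  Finiteness for [sigma i] is local
    integrability; for [nu] it follows from the pointwise bound of [nu] by the
    sum of the [`|sigma i|] ([nu_le_sum]). *)

Import Order.TTheory GRing.Theory Num.Theory.
Import numFieldNormedType.Exports.

Local Open Scope classical_set_scope.
Local Open Scope ring_scope.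

Set Implicit Arguments.
Unset Strict Implicit.
Unset Printing Implicit Defensive.

(** * Growth functions of class U and their inverses *)

Section class_U_theory.
Context {R : realType}.
Implicit Types (Phi : R -> R) (s t y c : R).

Lemma in_nneg t : (t \in (`[0, +oo[%classic : set R)) = (0 <= t).
Proof. by rewrite mem_setE in_itv /= andbT. Qed.

Lemma nnegE t : (`[0, +oo[%classic : set R) t = (0 <= t).
Proof. by rewrite /= in_itv /= andbT. Qed.

Lemma class_U_ge0 Phi t : class_U Phi -> 0 <= t -> 0 <= Phi t.
Proof.
move=> [q _ [[fPhi _ _ _ _] _ _]] t0.
by have := fPhi t; rewrite /= !in_itv /= !andbT; apply.
Qed.

Lemma class_U_surj Phi y : class_U Phi -> 0 <= y -> exists2 t, 0 <= t & Phi t = y.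
Proof.
move=> [q _ [[_ _ _ _ sPhi] _ _]] y0.
have /sPhi[t] : (`[0, +oo[%classic : set R) y by rewrite nnegE.
by rewrite nnegE => t0 <-; exists t.
Qed.

Lemma class_U_homo Phi s t : class_U Phi -> 0 <= s -> s <= t -> Phi s <= Phi t.
Proof.
move=> [q _ [[_ _ _ mPhi _] _ _]] s0 st; apply: mPhi => //.
  by rewrite in_itv /= andbT.
by rewrite in_itv /= andbT (le_trans s0).
Qed.

Lemma class_U0 Phi : class_U Phi -> Phi 0 = 0.
Proof.
move=> U; have [t t0 Phit] := class_U_surj U (lexx 0).
by apply/le_anti; rewrite class_U_ge0 // andbT -[leRHS]Phit class_U_homo.
Qed.

(** A zero at some [t > 0] would spread to all of [[t, +oo[] by the upper type
    condition, against surjectivity. *)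
Lemma class_U_gt0 Phi t : class_U Phi -> 0 < t -> 0 < Phi t.
Proof.
move=> U t0; rewrite ltNge; apply/negP => Phit_le0.
have Phit : Phi t = 0.
  by apply/le_anti; rewrite Phit_le0 class_U_ge0 // ltW.
have [s s0 Phis] := class_U_surj U (ler01 : 0 <= 1 :> R).
have [st|/ltW ts] := leP s t.
  by have := class_U_homo U s0 st; rewrite Phis Phit ler10.
have [q _ [_ [_ [C _ upC]] _]] := U.
have := upC t (s / t) t0; rewrite ler_pdivlMr // mul1r => /(_ ts).
by rewrite mulrCA divff ?gt_eqF // mulr1 Phis Phit mulr0 ler10.
Qed.

Lemma class_U_quotient Phi s t : class_U Phi -> 0 < s -> s <= t ->
  Phi s / s <= Phi t / t.
Proof.
move=> [q _ [_ _ qPhi]] s0 st.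
by apply: qPhi => //; rewrite in_itv /= andbT // (lt_le_trans s0).
Qed.

Lemma class_U_lt Phi s t : class_U Phi -> 0 <= s -> s < t -> Phi s < Phi t.
Proof.
move=> U; rewrite le_eqVlt => /predU1P[<- t0|s0 st].
  by rewrite class_U0 // class_U_gt0.
have t0 := lt_trans s0 st.
have := class_U_quotient U s0 (ltW st); rewrite ler_pdivrMr // => /le_lt_trans.
apply; rewrite -mulrA gtr_pMr ?class_U_gt0 //.
by rewrite mulrC ltr_pdivrMr // mul1r.
Qed.

Lemma class_U_scale Phi c t : class_U Phi -> 1 <= c -> 0 <= t ->
  c * Phi t <= Phi (c * t).
Proof.
move=> U c1; rewrite le_eqVlt => /predU1P[<-|t0].
  by rewrite mulr0 class_U0 // mulr0.
have c0 : 0 < c by rewrite (lt_le_trans ltr01).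
have tct : t <= c * t by rewrite ler_peMl // ltW.
have := class_U_quotient U t0 tct.
rewrite ler_pdivlMr ?mulr_gt0 // -mulrA (mulrCA t^-1) mulVf ?gt_eqF // mulr1.
by rewrite mulrC.
Qed.

Lemma class_U_bij Phi : class_U Phi -> set_bij `[0, +oo[ `[0, +oo[ Phi.
Proof.
move=> U; have [q _ [[fPhi _ _ _ sPhi] _ _]] := U.
split => // s t; rewrite !in_nneg => s0 t0 e.
case: (ltgtP s t) => // st.
  by have := class_U_lt U s0 st; rewrite e ltxx.
by have := class_U_lt U t0 st; rewrite e ltxx.
Qed.

Lemma inv_plusK Phi t : set_bij `[0, +oo[ `[0, +oo[ Phi -> 0 <= t ->
  inv_plus Phi (Phi t) = t.
Proof. by move=> [_ iPhi _] t0; rewrite /inv_plus pinvKV // in_nneg. Qed.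

Lemma inv_plus_surj Phi y : set_bij `[0, +oo[ `[0, +oo[ Phi -> 0 <= y ->
  0 <= inv_plus Phi y /\ Phi (inv_plus Phi y) = y.
Proof.
move=> bPhi; rewrite -nnegE => y0; have [_ _ sPhi] := bPhi.
have [t] := sPhi _ y0; rewrite nnegE => t0 <-.
by rewrite inv_plusK.
Qed.

(** The inverse is monotone and measurable on the whole line because it takes
    its default value 0 at points that [Phi] does not reach from [[0, +oo[]. *)
Lemma inv_plus_neg Phi y : set_bij `[0, +oo[ `[0, +oo[ Phi -> y < 0 ->
  inv_plus Phi y = 0.
Proof.
move=> [fPhi _ _] y0; rewrite /inv_plus /pinv_ functions.splitV /=.
rewrite (oinv_surj ((fun _ => id) : set_surj `[0, +oo[%classic (Phi @` `[0, +oo[%classic) Phi)).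
case: pselect => //= -[t t0 Phit]; have := fPhi t t0.
by rewrite Phit nnegE leNgt y0.
Qed.

Lemma inv_plus_ge0 Phi y : set_bij `[0, +oo[ `[0, +oo[ Phi -> 0 <= inv_plus Phi y.
Proof.
move=> bPhi; have [y0|y0] := leP 0 y; last by rewrite inv_plus_neg.
by have [] := inv_plus_surj bPhi y0.
Qed.

Lemma le_inv_plus Phi : class_U Phi -> {homo inv_plus Phi : s t / s <= t}.
Proof.
move=> U s t st; have bPhi := class_U_bij U.
have [s0|s0] := leP 0 s; last by rewrite inv_plus_neg // inv_plus_ge0.
have [is0 es] := inv_plus_surj bPhi s0.
have [it0 et] := inv_plus_surj bPhi (le_trans s0 st).
rewrite leNgt; apply/negP => /(class_U_lt U it0).
by rewrite es et ltNge st.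
Qed.

Lemma inv_plus_le0 Phi y : class_U Phi -> y <= 0 -> inv_plus Phi y = 0.
Proof.
move=> U y0; apply/le_anti; rewrite inv_plus_ge0 ?andbT; last exact: class_U_bij.
rewrite (le_trans (le_inv_plus U y0)) // -{1}(class_U0 U) inv_plusK //.
exact: class_U_bij.
Qed.

Lemma inv_plus_gt0 Phi y : class_U Phi -> 0 < y -> 0 < inv_plus Phi y.
Proof.
move=> U y0; have [iy0 e] := inv_plus_surj (class_U_bij U) (ltW y0).
rewrite lt_neqAle iy0 andbT eq_sym; apply/eqP => i0.
by move: e y0; rewrite i0 class_U0 // => <-; rewrite ltxx.
Qed.

(** Dual form of [class_U_scale]: the quotient [Phi t / t] is nondecreasing, so
    the inverse grows at most linearly. *)
Lemma inv_plus_scale Phi c y : class_U Phi -> 1 <= c -> 0 <= y ->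
  inv_plus Phi (c * y) <= c * inv_plus Phi y.
Proof.
move=> U c1 y0; have bPhi := class_U_bij U.
have [iy0 e] := inv_plus_surj bPhi y0.
rewrite -[leRHS](inv_plusK bPhi); last first.
  by rewrite mulr_ge0 // (le_trans ler01).
by apply: le_inv_plus => //; rewrite -{1}e class_U_scale.
Qed.

End class_U_theory.

(** * The bijection whose inverse is a product of inverses *)

Section product_inverse.
Context {R : realType} {n : nat}.
Variables (Phis : 'I_n -> R -> R) (Phi : R -> R).
Hypotheses (n_gt0 : (0 < n)%N) (Phis_U : forall i, class_U (Phis i)).
Hypothesis Phi_bij : set_bij `[0, +oo[ `[0, +oo[ Phi.
Hypothesis Phi_inv : forall t, 0 <= t ->
  inv_plus Phi t = \prod_(i < n) inv_plus (Phis i) t.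
Implicit Types (s t c : R).

Lemma prod_inv_ge0 (u : 'I_n -> R) : 0 <= \prod_(i < n) inv_plus (Phis i) (u i).
Proof. by apply: prodr_ge0 => i _; rewrite inv_plus_ge0 //; exact: class_U_bij. Qed.

(** [Phi] is only known to be a bijection; its monotonicity comes from that of
    its inverse, a product of nonnegative monotone functions. *)
Lemma product_homo s t : 0 <= s -> s <= t -> Phi s <= Phi t.
Proof.
move=> s0 st; have t0 := le_trans s0 st.
have [fPhi _ _] := Phi_bij.
have Phi_ge0 r : 0 <= r -> 0 <= Phi r.
  by move=> r0; have := fPhi r; rewrite !nnegE; apply.
rewrite leNgt; apply/negP => /[dup] lt_ts /ltW le_ts.
have : inv_plus Phi (Phi t) <= inv_plus Phi (Phi s).
  rewrite !Phi_inv ?Phi_ge0 //; apply: ler_prod => i _.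
  rewrite le_inv_plus // ?inv_plus_ge0 //; exact: class_U_bij.
rewrite !inv_plusK // => ts; have e : s = t by apply/le_anti/andP.
by move: lt_ts; rewrite e ltxx.
Qed.

Lemma product0 : Phi 0 = 0.
Proof.
have [_ e] := inv_plus_surj Phi_bij (lexx 0); rewrite -[RHS]e; congr (Phi _).
rewrite Phi_inv // (bigD1 (Ordinal n_gt0)) //= inv_plus_le0 ?mul0r //.
Qed.

Lemma product_gt0 t : 0 < t -> 0 < Phi t.
Proof.
move=> t0; have := product_homo (lexx 0) (ltW t0).
rewrite product0 le_eqVlt => /predU1P[|//] e.
have := inv_plusK Phi_bij (ltW t0).
by rewrite -e -product0 inv_plusK // => t00; rewrite t00 ltxx in t0.
Qed.

Lemma product_inv_scale c t : 1 <= c -> 0 <= t ->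
  inv_plus Phi (c * t) <= c ^+ n * inv_plus Phi t.
Proof.
move=> c1 t0; have c0 : 0 <= c by rewrite (le_trans ler01).
rewrite !Phi_inv ?mulr_ge0 // -[n in c ^+ n]card_ord -prodr_const -big_split /=.
apply: ler_prod => i _; rewrite inv_plus_scale // inv_plus_ge0 //.
exact: class_U_bij.
Qed.

Lemma product_inv_homo s t : 0 <= s -> s <= t -> inv_plus Phi s <= inv_plus Phi t.
Proof.
move=> s0 st; rewrite !Phi_inv ?(le_trans s0) //.
by apply: ler_prod => i _; rewrite le_inv_plus // inv_plus_ge0 //; exact: class_U_bij.
Qed.

(** With [s] the sum of the [`|u i|], every [(u i)^-1] is at least [s^-1], so
    the product is at least [inv_plus Phi s^-1], which [Phi] maps to [s^-1].
    Applied to [u i := sigma i x] this makes [nu] locally integrable. *)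
Lemma nu_le_sum (u : 'I_n -> R) :
  (Phi (\prod_(i < n) inv_plus (Phis i) (u i)^-1))^-1 <= \sum_(i < n) `|u i|.
Proof.
(* If some [u i <= 0], the left-hand side is 0 by the conventions [0^-1 = 0]
   and [inv_plus _ y = 0] for [y <= 0]. *)
have [[i ui]|u_gt0] := pselect (exists i, u i <= 0).
  rewrite (bigD1 i) //= inv_plus_le0 ?invr_le0 // mul0r product0 invr0.
  exact: sumr_ge0.
have {}u_gt0 i : 0 < u i.
  by rewrite ltNge; apply/negP => ui; apply: u_gt0; exists i.
have le_us i : u i <= \sum_(i < n) `|u i|.
  by rewrite (bigD1 i) //= ger0_norm ?(ltW (u_gt0 i)) // lerDl sumr_ge0.
set s := \sum_(i < n) _ in le_us *.
have s0 : 0 < s := lt_le_trans (u_gt0 (Ordinal n_gt0)) (le_us _).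
have sV0 : 0 <= s^-1 by rewrite invr_ge0 ltW.
have [is0 es] := inv_plus_surj Phi_bij sV0.
have leP : inv_plus Phi s^-1 <= \prod_(i < n) inv_plus (Phis i) (u i)^-1.
  rewrite Phi_inv //; apply: ler_prod => i _.
  rewrite inv_plus_ge0 ?le_inv_plus ?lef_pV2 ?posrE //; exact: class_U_bij.
rewrite -[leRHS]invrK lef_pV2 ?posrE ?invr_gt0 //; last first.
  by apply: product_gt0; apply: prodr_gt0 => i _; rewrite inv_plus_gt0 ?invr_gt0.
by rewrite -{1}es product_homo.
Qed.

End product_inverse.

(** * Measurability and positivity of integrals *)

Lemma measurable_inv (R : realType) : measurable_fun [set: R] (@GRing.inv R).
Proof.
have o0 : open (~` [set (0 : R)]) by apply: closed_openC; exact: closed_eq.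
(* Inversion is continuous off the origin, and every function is measurable on
   a single point. *)
rewrite -(setvU [set 0 : R]); apply/measurable_funU => //.
  exact: open_measurable.
split; last exact: measurable_fun_set1.
apply: open_continuous_measurable_fun => //.
by move=> x; rewrite inE /= => /eqP x0; exact: inv_continuous.
Qed.

Section Rintegral_positive.
Context d (T : measurableType d) (R : realType) (mu : {measure set T -> \bar R}).

Lemma Rintegral_gt0 (A : set T) (g : T -> R) : measurable A -> (0 < mu A)%E ->
  mu.-integrable A (EFin \o g) -> {ae mu, forall x, A x -> 0 < g x} ->
  0 < \int[mu]_(x in A) g x.
Proof.
move=> mA muA ig g0; have /integrableP[mg _] := ig.
have eg : ae_eq mu A (EFin \o g) (fun x => `|(g x)%:E|%E).
  by apply: filterS g0 => x gx Ax; rewrite /= ger0_norm // ltW // gx.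
have e : (\int[mu]_(x in A) (g x)%:E = \int[mu]_(x in A) `|(g x)%:E|)%E.
  by apply: ae_eq_integral => //; exact: measurableT_comp.
have fin : (\int[mu]_(x in A) (g x)%:E)%E \is a fin_num by exact: integrable_fin_num.
rewrite /Rintegral -lte_fin fineK // lt_neqAle e integral_ge0 // andbT eq_sym.
apply/eqP => /(ae_eq_integral_abs mu mA mg) g_eq0.
have : {ae mu, forall x, ~ A x}.
  apply: filterS2 g0 g_eq0 => x gx gx0 Ax.
  by have := gx Ax; have [->] := gx0 Ax; rewrite ltxx.
move/negligibleP; rewrite /= setCK => /(_ mA) A0.
by rewrite A0 ltxx in muA.
Qed.

End Rintegral_positive.

(** * Cubes in Euclidean space *)

Section boxes.
Context {R : realType}.

Definition box d (I : 'I_d -> interval R) : set 'rV[R]_d :=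
  [set x | forall i, x ord0 i \in I i].

Lemma measurable_box d (I : 'I_d -> interval R) : measurable (box I).
Proof.
rewrite (_ : box I = \bigcap_(i in [set: 'I_d])
    ((fun x : 'rV[R]_d => x ord0 i) @^-1` [set` I i])).
  apply: fin_bigcap_measurable => // i _; rewrite -[X in measurable X]setTI.
  by apply: measurable_coord_rV => //; exact: measurable_itv.
by apply/seteqP; split => x /= xI i; [move=> _|]; exact: xI.
Qed.

(** Lebesgue measure is an iterated product measure, so the measure of a box is
    the product of the lengths of its sides. *)
Lemma lebesgue_rV_box_gt0 d (I : 'I_d -> interval R) :
  (forall i, 0 < lebesgue_measure [set` I i])%E -> (0 < lebesgue_rV R d (box I))%E.
Proof.
elim: d I => [|d IH] I I0.
  rewrite /= /lebesgue_rV0 diracE mem_set ?lte01 //.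
  by case.
have -> : box I =
    uncons_rV @^-1` ([set` I ord0] `*` box (fun j => I (lift ord0 j))).
  apply/seteqP; split => x /=.
    by move=> xI; split => //= j; rewrite mxE.
  move=> [x0 xI] i; case: (unliftP ord0 i) => [j|] -> //.
  by have := xI j; rewrite mxE.
rewrite /= lebesgue_rVSE; [|exact: measurable_itv|exact: measurable_box].
by rewrite mule_gt0 // IH.
Qed.

Section cubes.
Context {d : nat}.
Local Notation mu := (@lebesgue_euclid R d).

Lemma cubeE (l : R) (Q : set (euclid R d)) : cube l Q -> exists a b c,
  Q = box (fun i => Interval (BSide (b i) (a i)) (BSide (c i) (a i + l))).
Proof. by move=> [a [b [c ->]]]; exists a, b, c. Qed.

Lemma euclid_measurable (Q : set 'rV[R]_d) :
  measurable Q -> measurable (Q : set (euclid R d)).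
Proof. exact: caratheodory_measurable_mu_ext. Qed.

Lemma measurable_cube l (Q : set (euclid R d)) : cube l Q -> measurable Q.
Proof.
move=> /cubeE[a [b [c ->]]]; apply: euclid_measurable.
exact: measurable_box.
Qed.

Lemma cube_gt0 l (Q : set (euclid R d)) : 0 < l -> cube l Q -> (0 < mu Q)%E.
Proof.
move=> l0 /cubeE[a [b [c ->]]].
rewrite /lebesgue_euclid /completed_measure_extension measurable_mu_extE /=; last first.
  exact: measurable_box.
apply: lebesgue_rV_box_gt0 => i; rewrite lebesgue_measure_itv /= lte_fin ltrDl l0.
by rewrite -EFinD addrAC subrr add0r lte_fin.
Qed.

(** Weights are integrable over compact sets, and a cube need not contain its
    faces. *)
Lemma cube_compact l (Q : set (euclid R d)) : cube l Q ->
  exists K : set 'rV[R]_d, [/\ compact K, measurable (K : set (euclid R d)) & Q `<=` K].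
Proof.
move=> /cubeE[a [b [c ->]]].
exists (box (fun i => `[a i, a i + l])); split.
- have := @rV_compact R d (fun i => `[a i, a i + l]%classic).
  by apply => i; exact: segment_compact.
- by apply: euclid_measurable; exact: measurable_box.
- move=> x xQ i; have := xQ i; rewrite !itv_boundlr => /andP[l1 l2].
  apply/andP; split; [apply: le_trans l1|apply: le_trans l2 _].
    by rewrite bnd_simp.
  by rewrite bnd_simp.
Qed.

Lemma integrable_weight_cube sigma l (Q : set (euclid R d)) :
  weight sigma -> cube l Q -> mu.-integrable Q (EFin \o sigma).
Proof.
move=> [msigma lsigma _] /[dup] /measurable_cube mQ /cube_compact[K [cK mK QK]].
apply: (integrableS mK mQ QK); apply/integrableP; split.
  by apply/measurable_EFinP; exact: measurable_funTS.
exact: lsigma.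
Qed.

End cubes.
End boxes.

(** * Indicators as test functions *)

Section test_functions.
Context {R : realType} {d : nat}.
Local Notation mu := (@lebesgue_euclid R d).
Implicit Types (sigma : euclid R d -> R) (S Q : set (euclid R d)).

Definition cindic S : euclid R d -> R[i] := fun x => ((\1_S x : R)%:C)%C.

Lemma normc_real (r : R) : ComplexField.Normc.normc (r%:C)%C = `|r|.
Proof. by rewrite /= expr0n addr0 sqrtr_sqr. Qed.

Lemma normc_cindic S x : ComplexField.Normc.normc (cindic S x) = \1_S x.
Proof. by rewrite normc_real ger0_norm. Qed.

(** The modular of the indicator of [S] at scale [l] is [Phi l^-1 * w], with
    [w] the [sigma]-measure of [S]; it is at most 1 exactly when [l^-1] is at
    most the inverse of [Phi] at [w^-1]. *)
Lemma luxemburg_cindic Phi sigma S : class_U Phi -> measurable S ->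
  mu.-integrable S (EFin \o sigma) -> 0 < weighted_measure sigma S ->
  luxemburg_norm Phi sigma (cindic S) =
    ((inv_plus Phi (weighted_measure sigma S)^-1)^-1)%:E.
Proof.
move=> U mS iS; set w := weighted_measure sigma S => w0.
have wV0 : 0 < w^-1 by rewrite invr_gt0.
set v := inv_plus Phi w^-1; have v0 : 0 < v by exact: inv_plus_gt0.
have Phiv : Phi v = w^-1.
  by have [] := inv_plus_surj (class_U_bij U) (ltW wV0).
have modular l : 0 < l ->
    (\int[mu]_x (Phi (ComplexField.Normc.normc (cindic S x) / l) * sigma x)%:E
      = (Phi l^-1 * w)%:E)%E.
  move=> l0; transitivity (\int[mu]_(x in S) ((Phi l^-1)%:E * (sigma x)%:E))%E.
    rewrite [RHS]integral_mkcond; apply: eq_integral => x _.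
    rewrite patchE normc_cindic indicE; case: ifPn => xS; first by rewrite mul1r.
    by rewrite mul0r class_U0 // mul0r.
  rewrite integralZl // EFinM; congr (_ * _)%E.
  by rewrite fineK //; exact: integrable_fin_num.
apply/le_anti/andP; split.
  apply: ereal_inf_lbound; exists v^-1 => //=; split; first by rewrite invr_gt0.
  by rewrite modular ?invr_gt0 // invrK Phiv mulVf // gt_eqF.
apply: le_ereal_inf_tmp => _ [l /= [l0]] + <-.
rewrite modular // !lee_fin -ler_pdivlMr // div1r -Phiv => Phil.
rewrite -[leRHS]invrK lef_pV2 ?posrE ?invr_gt0 //.
by rewrite leNgt; apply/negP => /(class_U_lt U (ltW v0)); rewrite ltNge Phil.
Qed.

Lemma orlicz_cindic Phi sigma S : measurable S ->
  (luxemburg_norm Phi sigma (cindic S) < +oo)%E -> orlicz Phi sigma (cindic S).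
Proof.
move=> mS lS; split => //=; first exact: measurable_indic.
Qed.

Lemma cindic_neq0 S : measurable S -> (0 < mu S)%E -> ~ ae_zero (cindic S).
Proof.
move=> mS S0 z; have : {ae mu, forall x, ~ S x}.
  apply: filterS z => x + xS; rewrite /cindic indicE mem_set // => /eqP.
  by rewrite eq_complex /= oner_eq0.
move/negligibleP; rewrite /= setCK => /(_ mS) e.
by rewrite e ltxx in S0.
Qed.

Lemma weighted_mean_cindic sigma S Q N : Q `<=` S -> 0 < N -> measurable Q ->
  mu.-integrable Q (EFin \o sigma) -> 0 < weighted_measure sigma Q ->
  weighted_mean sigma (fun x => cindic S x / (N%:C)%C) Q = N^-1.
Proof.
move=> QS N0 mQ iQ Q0; rewrite /weighted_mean.
rewrite (_ : \int[mu]_(x in Q) _ = N^-1 * weighted_measure sigma Q).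
  by rewrite mulrCA mulVf ?mulr1 // gt_eqF.
rewrite -RintegralZl //; apply: eq_Rintegral => x /set_mem /QS xS.
rewrite ComplexField.Normc.normcM ComplexField.Normc.normcV normc_cindic normc_real.
by rewrite indicE mem_set // mul1r ger0_norm // ltW.
Qed.

End test_functions.

(** * The weight nu *)

Section nu_weight.
Context {R : realType} {d n : nat}.
Local Notation mu := (@lebesgue_euclid R d).
Variables (Phis : 'I_n -> R -> R) (Phi : R -> R).
Variable sigma : 'I_n -> euclid R d -> R.
Hypotheses (n_gt0 : (0 < n)%N) (Phis_U : forall i, class_U (Phis i)).
Hypothesis Phi_bij : set_bij `[0, +oo[ `[0, +oo[ Phi.
Hypothesis Phi_inv : forall t, 0 <= t ->
  inv_plus Phi t = \prod_(i < n) inv_plus (Phis i) t.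
Hypothesis weight_sigma : forall i, weight (sigma i).

Let nu := nu_sigma Phi Phis sigma.

(** [nu] is built from the measurable [sigma i] by inversion, products and
    monotone functions. *)
Lemma measurable_nu : measurable_fun [set: euclid R d] nu.
Proof.
apply: measurableT_comp; first exact: measurable_inv.
(* Nothing is known of [Phi] on the negative reals, which the product of
   inverses avoids. *)
have mPhi : measurable_fun [set: R] (fun t => Phi (Num.max 0 t)).
  apply: nondecreasing_measurable => // s t st.
  apply: (product_homo Phis_U) => //; first by rewrite le_max lexx.
  by rewrite ge_max !le_max lexx st orbT.
have -> : (fun x => Phi (\prod_(i < n) inv_plus (Phis i) (sigma i x)^-1)) =
    (fun t => Phi (Num.max 0 t)) \o
    (fun x => \prod_(i < n) inv_plus (Phis i) (sigma i x)^-1).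
  by apply/funext => x /=; rewrite max_r // prod_inv_ge0.
apply: measurableT_comp => //; apply: measurable_prod => i _.
apply: (measurableT_comp (f := inv_plus (Phis i))).
  by apply: nondecreasing_measurable => //; exact: le_inv_plus.
apply: measurableT_comp; first exact: measurable_inv.
by have [] := weight_sigma i.
Qed.

Lemma integrable_nu l Q : cube l Q -> mu.-integrable Q (EFin \o nu).
Proof.
move=> cQ; have mQ := measurable_cube cQ.
have iS : mu.-integrable Q (fun x => \sum_(i < n) (`|sigma i x|)%:E)%E.
  apply: integrable_sum => // i _.
  exact/integrable_norm/(integrable_weight_cube (weight_sigma i) cQ).
apply: (le_integrable mQ _ _ iS).
  by apply/measurable_EFinP; apply: measurable_funTS; exact: measurable_nu.
move=> x _; rewrite sumEFin /= lee_fin [leRHS]ger0_norm ?sumr_ge0 //.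
rewrite ger0_norm; first exact: nu_le_sum.
rewrite invr_ge0 -(product0 n_gt0 Phis_U Phi_bij Phi_inv).
by apply: (product_homo Phis_U) => //; exact: prod_inv_ge0.
Qed.

Lemma nu_gt0 l Q : 0 < l -> cube l Q -> 0 < weighted_measure nu Q.
Proof.
move=> l0 cQ; apply: Rintegral_gt0.
- exact: measurable_cube cQ.
- exact: cube_gt0 cQ.
- exact: integrable_nu cQ.
have : {ae mu, forall x, forall i, 0 < sigma i x}.
  by apply: filter_forall => i; have [] := weight_sigma i.
apply: filterS => x sx _; rewrite /nu /nu_sigma invr_gt0.
apply: (product_gt0 n_gt0 Phis_U) => //.
by apply: prodr_gt0 => i _; rewrite inv_plus_gt0 ?invr_gt0.
Qed.

End nu_weight.

Lemma weighted_measure_gt0 (R : realType) d (sigma : euclid R d -> R) l Q :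
  weight sigma -> 0 < l -> cube l Q -> 0 < weighted_measure sigma Q.
Proof.
move=> ws l0 cQ; apply: Rintegral_gt0.
- exact: measurable_cube cQ.
- exact: cube_gt0 cQ.
- exact: integrable_weight_cube ws cQ.
- by have [_ _] := ws; apply: filterS.
Qed.

(** * The Carleson condition *)

Unset Implicit Arguments.

Theorem proposition3p3 (R : realType) (d n : nat) (d_gt0 : (0 < d)%N)
    (n_gt0 : (0 < n)%N)
    (D : set (set (euclid R d))) (gridD : dyadic_grid D)
    (lambda : set (euclid R d) -> R)
    (lambda_gt0 : forall Q, D Q -> 0 < lambda Q)
    (sigma : 'I_n -> euclid R d -> R)
    (weight_sigma : forall i, weight (sigma i))
    (Phis : 'I_n -> R -> R) (Psi Phi : R -> R)
    (Phis_U : forall i, class_U (Phis i) /\ regular_growth (Phis i))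
    (Psi_U : class_U Psi /\ regular_growth Psi)
    (Phi_bij : set_bij `[0, +oo[ `[0, +oo[ Phi)
    (Phi_inv : forall t, 0 <= t ->
       inv_plus Phi t = \prod_(i < n) inv_plus (Phis i) t)
    (Psi_Phi : {in `]0, +oo[ &, {homo (fun t => Psi t / Phi t) : s t / s <= t}})
    (C1 C2 : R) (C1_gt0 : 0 < C1) (C2_gt0 : 0 < C2)
    (nu_le : forall Q, D Q ->
       (weighted_measure (nu_sigma Phi Phis sigma) Q)^-1 <=
       C1 * Phi (\prod_(i < n)
         inv_plus (Phis i) (weighted_measure (sigma i) Q)^-1))
    (sum_le : forall f : 'I_n -> euclid R d -> R[i],
       (forall i, orlicz (Phis i) (sigma i) (f i) /\ ~ ae_zero (f i)) ->
       (\esum_(Q in D)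
          (lambda Q * Psi (\prod_(i < n) weighted_mean (sigma i)
             (fun x => f i x /
                ((fine (luxemburg_norm (Phis i) (sigma i) (f i)))%:C)%C) Q))%:E
        <= C2%:E)%E) :
  carleson D (nu_sigma Phi Phis sigma) (Psi \o inv_plus Phi) lambda.
Proof.
have {}Phis_U i : class_U (Phis i) by have [] := Phis_U i.
have [{}Psi_U _] := Psi_U.
have [q _ [_ [_ [Cq Cq0 upPsi]] _]] := Psi_U.
have cubeD Q : D Q -> exists2 l : R, 0 < l & cube l Q.
  by have [+ _ _ DQ] := gridD => /(_ Q DQ)[k cQ]; exists (2 ^ k) => //; exact: exprz_gt0.
(* The scaling bound for the inverses and the upper type of [Psi] need factors
   at least 1. *)
pose c := Num.max 1 C1.
have c1 : 1 <= c by rewrite le_max lexx.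
have c0 : 0 < c := lt_le_trans ltr01 c1.
exists (C2 * (Cq * (c ^+ n) `^ q)).
  by rewrite !mulr_gt0 // powR_gt0 // exprn_gt0.
move=> S DS; have [l l0 cS] := cubeD S DS.
have mS := measurable_cube cS.
have S0 i : 0 < weighted_measure (sigma i) S by exact: weighted_measure_gt0 cS.
set v := fun i => inv_plus (Phis i) (weighted_measure (sigma i) S)^-1.
have v0 i : 0 < v i by rewrite inv_plus_gt0 ?invr_gt0.
pose P := \prod_(i < n) v i.
have P0 : 0 < P by exact: prodr_gt0.
have PsiP0 : 0 < Psi P by exact: class_U_gt0.
have norm_S i : luxemburg_norm (Phis i) (sigma i) (cindic S) = ((v i)^-1)%:E.
  by apply: luxemburg_cindic => //; exact: integrable_weight_cube cS.
have test i : orlicz (Phis i) (sigma i) (cindic S) /\ ~ ae_zero (cindic S).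
  split; last by apply: cindic_neq0 => //; exact: cube_gt0 cS.
  by apply: orlicz_cindic => //; rewrite norm_S ltry.
have test_sum : (\esum_(Q in [set Q | D Q /\ Q `<=` S]) (lambda Q)%:E
    <= (C2 / Psi P)%:E)%E.
  apply: ge_ereal_sup => _ [A [finA subA] <-].
  rewrite fsumEFin // lee_fin ler_pdivlMr // mulr_fsuml -lee_fin -fsumEFin //.
  apply: le_trans (sum_le (fun=> cindic S) test).
  apply: ereal_sup_ubound; exists A; first by split=> // Q /subA[].
  apply: eq_fsbigr => Q /set_mem /subA[DQ QS]; congr (_ * Psi _)%:E.
  apply: eq_bigr => i _; have [lQ lQ0 cQ] := cubeD Q DQ.
  rewrite norm_S weighted_mean_cindic ?invrK ?invr_gt0 //.
  - exact: measurable_cube cQ.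
  - exact: integrable_weight_cube cQ.
  - exact: weighted_measure_gt0 cQ.
apply: le_trans test_sum _; rewrite lee_fin /=.
set w := (weighted_measure (nu_sigma Phi Phis sigma) S)^-1.
have w0 : 0 < w by rewrite invr_gt0; exact: nu_gt0 cS.
have Psiw0 : 0 < Psi (inv_plus Phi w).
  apply: class_U_gt0 => //; rewrite Phi_inv ?(ltW w0) //.
  by apply: prodr_gt0 => i _; exact: inv_plus_gt0.
rewrite -mulrA ler_pM2l // ler_pdivlMr // mulrC ler_pdivrMr //.
have PhiP0 : 0 < Phi P by exact: (product_gt0 n_gt0 Phis_U).
have wP : inv_plus Phi w <= P * c ^+ n.
  rewrite mulrC -[in leRHS](inv_plusK Phi_bij (ltW P0)).
  apply: (le_trans _ (product_inv_scale Phis_U Phi_inv c1 (ltW PhiP0))).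
  apply: (product_inv_homo Phis_U Phi_inv (ltW w0)).
  apply: le_trans (nu_le S DS) _.
  by rewrite ler_pM2r // le_max lexx orbT.
apply: le_trans (upPsi P (c ^+ n) P0 _); last by rewrite exprn_ege1.
apply: class_U_homo => //; exact: inv_plus_ge0.
Qed.
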